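(* Let $f$ be a spectral density on $\Lambda$ with $f>0$ a.e. on $S:=\{\lambda: e^{i\lambda}\in\overline{E_f}\}$. Then: (a) If $\overline{E_f}=\Gamma_{2\alpha}(\theta_0)$ with $0<\alpha<\pi$, then $\lim_{n\to\infty}\sqrt[n]{\sigma_n(f)}=\sin(\alpha/2)$. (b) If $\overline{E_f}=\Gamma(k,\alpha)$ (with $k\ge2$, $\alpha>0$, $k\alpha<2\pi$), then $\lim_{n\to\infty}\sqrt[n]{\sigma_n(f)}=(\sin(k\alpha/4))^{1/k}$. (c) If $\overline{E_f}=\Gamma_{\alpha,\delta}(\theta_0)$ with $\alpha>0$, $\delta\ge0$, $\alpha+\delta\le\pi$, then $\lim_{n\to\infty}\sqrt[n]{\sigma_n(f)}=(\sin(\alpha/2)\sin(\alpha/2+\delta))^{1/2}$. (d) If $\overline{E_f}=\Delta_{\alpha,\delta}(\theta_0)$ with $\alpha>0$, $\delta\ge0$, $\alpha+\delta\le\pi/2$, then $\lim_{n\to\infty}\sqrt[n]{\sigma_n(f)}=(\sin\alpha\,\sin(\alpha+2\delta))^{1/4}$.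
   Context: $\Lambda=[-\pi,\pi]$. A spectral density is $f\ge0$, $f\in L^1(\Lambda)$, positive on a set of positive measure; $E_f=\{e^{i\lambda}:f(\lambda)>0\}$, $\overline{E_f}$ its closure. $\sigma_n^2(f)=\min_{c_1,\dots,c_n\in\mathbb C}\int_\Lambda|1-\sum_{k=1}^n c_ke^{-ik\lambda}|^2f(\lambda)\,d\lambda$, $\sigma_n(f)=\sqrt{\sigma_n^2(f)}$. Sets on the unit circle, for $\theta_0\in[-\pi,\pi)$: $\Gamma_{2\alpha}(\theta_0)=\{e^{i\theta}:|\theta-\theta_0|\le\alpha\}$ (closed arc of length $2\alpha$ centered at $e^{i\theta_0}$); $\Gamma_{\alpha,\delta}(\theta_0)=\{e^{i\theta}:\delta\le|\theta-\theta_0|\le\delta+\alpha\}$ (two closed arcs of length $\alpha$ at circular distance $2\delta$); $\Gamma(k,\alpha)$ = union of $k$ closed arcs of equal length $\alpha$ placed equidistantly on the unit circle (i.e. up to rotation, the preimage under $z\mapsto z^k$ of an arc of length $k\alpha$); $\Delta_{\alpha,\delta}(\theta_0)=e^{i\theta_0}\cdot\big(\Gamma_{\alpha,\delta}(0)\cup\Gamma'_{\alpha,\delta}\big)$ where $\Gamma'_{\alpha,\delta}=\{e^{i\theta}:\theta\in[-\pi+\delta,-\pi+\delta+\alpha]\cup[\pi-\delta-\alpha,\pi-\delta]\}$ (four arcs of length $\alpha$ symmetric with respect to both axes, rotated by $\theta_0$). *)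

(* Defs.v *)
From HB Require Import structures.
From mathcomp Require Import all_boot all_order all_algebra.
From mathcomp Require Import all_classical all_reals all_analysis.
Set Implicit Arguments. Unset Strict Implicit. Unset Printing Implicit Defensive.
Import Order.TTheory GRing.Theory Num.Theory.
Import numFieldNormedType.Exports.
Local Open Scope classical_set_scope.
Local Open Scope ring_scope.

Section Defs.
Variable R : realType.

Definition Lam : set R := `[- pi, pi].

Definition ei (t : R) : R * R := (cos t, sin t).

Definition spectral_density (f : R -> R) : Prop :=
  (forall x, Lam x -> 0 <= f x) /\
  lebesgue_measure.-integrable Lam (EFin \o f) /\
  (0 < lebesgue_measure [set x | Lam x /\ (0 < f x)%R])%E.

Definition Ef (f : R -> R) : set (R * R) := ei @` [set x | Lam x /\ 0 < f x].
Definition clEf (f : R -> R) : set (R * R) := closure (Ef f).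

(* |1 - sum_{k=1}^n c_k e^{-i k x}|^2 with c_k = (c k).1 + i (c k).2 *)
Definition trig_abs2 (n : nat) (c : 'I_n -> R * R) (x : R) : R :=
  (1 - \sum_(k < n) ((c k).1 * cos (k.+1%:R * x) + (c k).2 * sin (k.+1%:R * x))) ^+ 2
  + (\sum_(k < n) ((c k).2 * cos (k.+1%:R * x) - (c k).1 * sin (k.+1%:R * x))) ^+ 2.

(* sigma_n^2(f) (the minimum, written as the infimum, which is attained) *)
Definition sigma2 (n : nat) (f : R -> R) : \bar R :=
  ereal_inf [set (\int[lebesgue_measure]_(x in Lam) (trig_abs2 c x * f x)%:E)%E
            | c in [set: 'I_n -> R * R]].

Definition sigma (n : nat) (f : R -> R) : R := Num.sqrt (fine (sigma2 n f)).

Definition Gamma_arc (alpha theta0 : R) : set (R * R) :=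
  ei @` [set t | `|t - theta0| <= alpha].

(* Gamma(k, alpha), rotated by theta0: k arcs of length alpha centred at
   theta0 + 2 pi j / k *)
Definition Gamma_k (k : nat) (alpha theta0 : R) : set (R * R) :=
  ei @` [set t | exists j : nat, (j < k)%N /\
          `|t - (theta0 + 2 * pi * j%:R / k%:R)| <= alpha / 2].

Definition Gamma_ad (alpha delta theta0 : R) : set (R * R) :=
  ei @` [set t | delta <= `|t - theta0| <= delta + alpha].

Definition Delta_ad (alpha delta theta0 : R) : set (R * R) :=
  ei @` [set t | (delta <= `|t - theta0| <= delta + alpha) \/
                 (- pi + delta <= t - theta0 <= - pi + delta + alpha) \/
                 (pi - delta - alpha <= t - theta0 <= pi - delta)].

End Defs.

(* Main.v *)
Require Import Defs.
From HB Require Import structures.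
From mathcomp Require Import all_boot all_order all_algebra.
From mathcomp Require Import all_classical all_reals all_analysis.
From mathcomp Require Import measurable_realfun ring lra zify.
Import Order.TTheory GRing.Theory Num.Theory.
Import numFieldNormedType.Exports.
Local Open Scope classical_set_scope.
Local Open Scope ring_scope.
Set Implicit Arguments.
Unset Strict Implicit.
Unset Printing Implicit Defensive.

(** In the variable x = cos (m (t - theta)) each of the four sets is the
    preimage of one interval [a, b] of [-1, 1], and the limit is
    ((b - a) / 2)^(1 / 2m).  The upper bound comes from the Chebyshev polynomials
    of [a, b], which become polynomials in e^{-it} with constant term 1.  For the
    lower bound, turn 1 - sum_k c_k e^{-ikt} by a suitable e^{int}, take real
    parts and average over the 2m preimages of x: this gives a real polynomial in
    x of known leading coefficient, dominated by the given trigonometric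
    polynomial on the fibre.  Off a set of small measure the latter is controlled
    by the weighted L^2 norm because f > 0 a.e. on the set, the map
    t |-> x is Lipschitz and hence keeps the exceptional set small, and Polya's
    inequality bounds from below the maximum of a polynomial with given leading
    coefficient on any set of measure L by a multiple of (L / 4)^n. *)

(** * Chebyshev polynomials and their nodes *)

Fixpoint chebT (R : nzRingType) (n : nat) : {poly R} :=
  match n with
  | 0 => 1
  | n'.+1 => match n' with
             | 0 => 'X
             | n''.+1 => ('X * chebT R n') *+ 2 - chebT R n''
             end
  end.

Lemma chebTSS (R : nzRingType) n :
  chebT R n.+2 = ('X * chebT R n.+1) *+ 2 - chebT R n.
Proof. by []. Qed.

Lemma nat_ind2 (P : nat -> Prop) :
  P 0 -> P 1 -> (forall n, P n -> P n.+1 -> P n.+2) -> forall n, P n.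
Proof.
move=> P0 P1 PS n; suff: P n /\ P n.+1 by case.
by elim: n => // n [Pn Pn1]; split => //; exact: PS.
Qed.

Lemma cosSS (R : realType) n (u : R) :
  cos (n.+2%:R * u) = 2 * cos u * cos (n.+1%:R * u) - cos (n%:R * u).
Proof.
have -> : n.+2%:R * u = n.+1%:R * u + u by rewrite -(natr1 n.+1); ring.
have -> : n%:R * u = n.+1%:R * u - u by rewrite -(natr1 n); ring.
by rewrite cosD cosB; ring.
Qed.

Lemma sinSS (R : realType) n (u : R) :
  sin (n.+2%:R * u) = 2 * cos u * sin (n.+1%:R * u) - sin (n%:R * u).
Proof.
have -> : n.+2%:R * u = n.+1%:R * u + u by rewrite -(natr1 n.+1); ring.
have -> : n%:R * u = n.+1%:R * u - u by rewrite -(natr1 n); ring.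
by rewrite sinD sinB; ring.
Qed.

Lemma chebT_cos (R : realType) n (u : R) : (chebT R n).[cos u] = cos (n%:R * u).
Proof.
elim/nat_ind2: n => [||n IH0 IH1]; first by rewrite hornerE mul0r cos0.
  by rewrite hornerE mul1r.
by rewrite chebTSS cosSS !(hornerD, hornerN, hornerMn, hornerM, hornerX) IH0 IH1; ring.
Qed.

(** This is [chebT_cos] differentiated; the factor [sin u] avoids a division, so the three-term
    recurrence proves it for every [u]. *)
Lemma chebT_deriv (R : realType) n (u : R) :
  (chebT R n)^`().[cos u] * sin u = n%:R * sin (n%:R * u).
Proof.
elim/nat_ind2: n => [||n IH0 IH1]; first by rewrite derivC horner0 !mul0r.
  by rewrite derivX hornerE !mul1r.
rewrite chebTSS derivB derivMn derivM derivX mul1r !(hornerD, hornerN, hornerMn, hornerM, hornerX) chebT_cos.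
transitivity (2 * (cos (n.+1%:R * u) * sin u
  + cos u * ((chebT R n.+1)^`().[cos u] * sin u))
  - (chebT R n)^`().[cos u] * sin u); first by ring.
rewrite IH0 IH1 sinSS.
have -> : n%:R * u = n.+1%:R * u - u by rewrite -(natr1 n); ring.
by rewrite sinB -(natr1 n.+1) -(natr1 n); ring.
Qed.

Lemma size_lead_chebT (R : numDomainType) n :
  size (chebT R n) = n.+1 /\ lead_coef (chebT R n) = 2 ^+ n.-1.
Proof.
elim/nat_ind2: n => [||n [s0 l0] [s1 l1]].
- by rewrite size_poly1 lead_coef1.
- by rewrite size_polyX lead_coefX.
have two0 : (2 : R) != 0 by rewrite pnatr_eq0.
have X0 : chebT R n.+1 != 0 by rewrite -size_poly_eq0 s1.
have eX : ('X * chebT R n.+1) *+ 2 = 2 *: ('X * chebT R n.+1).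
  by rewrite -scaler_nat.
have sX : size ('X * chebT R n.+1 *+ 2) = n.+3.
  by rewrite eX size_scale // mulrC size_mulX // s1.
have lt : (size (- chebT R n)%R < size ('X * chebT R n.+1 *+ 2)%R)%N.
  by rewrite size_polyN sX s0.
rewrite chebTSS; split; first by rewrite size_polyDl.
by rewrite lead_coefDl // eX lead_coefZ ['X * _]mulrC lead_coefMX l1 /= exprS.
Qed.

Lemma size_chebT (R : numDomainType) n : size (chebT R n) = n.+1.
Proof. by have [] := size_lead_chebT R n. Qed.

Lemma lead_coef_chebT (R : numDomainType) n :
  lead_coef (chebT R n) = 2 ^+ n.-1.
Proof. by have [] := size_lead_chebT R n. Qed.

(** The cosines of these angles, for [j < N], are the zeros of [chebT R N]. *)
Definition cheb_angle (R : realType) (N j : nat) : R :=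
  (2 * j%:R + 1) * pi / (2 * N%:R).

Lemma cheb_angle_itv (R : realType) N j : (j < N)%N ->
  0 < cheb_angle R N j < pi.
Proof.
move=> jN; have N0 : (0 : R) < N%:R by rewrite ltr0n (leq_ltn_trans _ jN).
have p0 := pi_gt0 R.
have j0 : (0 : R) <= j%:R by rewrite ler0n.
have jN' : j%:R + 1 <= N%:R :> R by rewrite natr1 ler_nat.
rewrite /cheb_angle; apply/andP; split.
  by rewrite divr_gt0 // mulr_gt0 //; lra.
rewrite ltr_pdivrMr; last by lra.
by rewrite mulrC ltr_pM2l //; lra.
Qed.

Lemma cos_natpi (R : realType) j : cos (j%:R * pi : R) = (-1) ^+ j.
Proof.
elim: j => [|j IH]; first by rewrite mul0r cos0.
by rewrite -natr1 mulrDl mul1r cosDpi IH exprS mulN1r.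
Qed.

Lemma sin_natpi (R : realType) j : sin (j%:R * pi : R) = 0.
Proof.
elim: j => [|j IH]; first by rewrite mul0r sin0.
by rewrite -natr1 mulrDl mul1r sinDpi IH oppr0.
Qed.

Lemma mul_cheb_angle (R : realType) N j : (0 < N)%N ->
  N%:R * cheb_angle R N j = j%:R * pi + pi / 2.
Proof.
move=> N0; have N0' : (N%:R : R) != 0 by rewrite pnatr_eq0 -lt0n.
by rewrite /cheb_angle; field.
Qed.

Lemma cheb_angle_inj (R : realType) N i j : (0 < N)%N ->
  cheb_angle R N i = cheb_angle R N j -> i = j.
Proof.
move=> N0 /(congr1 (fun x => N%:R * x)); rewrite !mul_cheb_angle // => /addIr.
move/mulIf => /(_ (lt0r_neq0 (pi_gt0 R))) /eqP.
by rewrite eqr_nat => /eqP.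
Qed.

Lemma chebT_prod (R : realType) N : (0 < N)%N ->
  chebT R N = 2 ^+ N.-1 *: \prod_(j < N) ('X - (cos (cheb_angle R N j))%:P).
Proof.
move=> N0; rewrite -lead_coef_chebT.
have -> : \prod_(j < N) ('X - (cos (cheb_angle R N j))%:P) =
  \prod_(z <- [seq cos (cheb_angle R N j) | j : 'I_N <- enum 'I_N]) ('X - z%:P).
  by rewrite big_map big_enum.
apply: all_roots_prod_XsubC.
- by rewrite size_chebT size_map size_enum_ord.
- apply/allP => _ /mapP[j _ ->]; rewrite /root chebT_cos mul_cheb_angle //.
  by rewrite cosDpihalf sin_natpi oppr0.
rewrite uniq_rootsE map_inj_in_uniq ?enum_uniq // => i j _ _ eij.
apply/val_inj/(@cheb_angle_inj R N) => //; apply: cos_inj => //;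
  by rewrite in_itv /=; apply/andP; split; apply/ltW;
     have /andP[? ?] := cheb_angle_itv R (ltn_ord i); have /andP[? ?] := cheb_angle_itv R (ltn_ord j).
Qed.

(** The product is [|T_N'| / 2^(N-1)] at the node [cos u]. There [|T_N'| sin u = N] by
    [chebT_deriv], because [sin (N u)] is 1 or -1, and [sin u <= 1]. *)
Lemma cheb_nodes_prod (R : realType) N (j : 'I_N) :
  N%:R / 2 ^+ N.-1 <=
  \prod_(i < N | i != j) `|cos (cheb_angle R N j) - cos (cheb_angle R N i)|.
Proof.
have N0 : (0 < N)%N by exact: leq_ltn_trans (ltn_ord j).
set u := cheb_angle R N.
have /andP[u0 upi] : 0 < u j < pi := cheb_angle_itv R (ltn_ord j).
have := chebT_deriv N (u j); rewrite mul_cheb_angle // chebT_prod //.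
(* At a root, only the term that differentiates the vanishing factor survives. *)
rewrite (bigD1 j) //= derivZ derivM derivXsubC mul1r !hornerE subrr mul0r addr0.
rewrite horner_prod sinDpihalf cos_natpi -/u => /(congr1 Num.norm).
rewrite !normrM !normrX normrN1 expr1n mulr1 !normr_nat normr_prod.
rewrite (gtr0_norm (sin_gt0_pi _)) ?u0 //.
under eq_bigr => i _ do rewrite !hornerE.
move=> <-.
have e0 : (2 : R) ^+ N.-1 != 0 by rewrite expf_neq0.
rewrite -(mulrA (2 ^+ _)) mulrAC mulfV // mul1r.
by rewrite ler_piMr ?sin_le1 // ?prodr_ge0.
Qed.

(** * Lagrange interpolation at well-spaced nodes *)

(** Compares the coefficients of degree [N - 1] in Lagrange's formula; the unnormalised basis
    polynomials [l j] are monic of that degree. *)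
Lemma lead_coef_lagrange (F : fieldType) N (p : {poly F}) (x : 'I_N -> F) :
  injective x -> (size p <= N)%N ->
  p`_N.-1 = \sum_(j < N) p.[x j] / \prod_(i < N | i != j) (x j - x i).
Proof.
move=> xI sp.
pose l j := \prod_(i < N | i != j) ('X - (x i)%:P).
have sl j : size (l j) = N.
  rewrite /l size_prod => [|i _]; last by rewrite polyXsubC_eq0.
  under eq_bigr => i _ do rewrite size_XsubC.
  rewrite sum_nat_const cardC1 card_ord.
  by have := ltn_ord j; lia.
have lj j : (l j).[x j] = \prod_(i < N | i != j) (x j - x i).
  by rewrite horner_prod; under eq_bigr => i _ do rewrite !hornerE.
have lj0 j : (l j).[x j] != 0.
  by rewrite lj; apply/prodf_neq0 => i ij; rewrite subr_eq0 inj_eq // eq_sym.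
have lk j k : k != j -> (l j).[x k] = 0.
  by move=> kj; rewrite /l (bigD1 k) //= hornerM !hornerE subrr mul0r.
pose q := \sum_(j < N) (p.[x j] / (l j).[x j]) *: l j.
have sq : (size q <= N)%N.
  rewrite (leq_trans (size_sum _ _ _)) //; apply/bigmax_leqP => j _.
  by rewrite (leq_trans (size_scale_leq _ _)) // sl.
(* [p - q] has size at most [N] and vanishes at the [N] distinct points [x j]. *)
have pq : p = q.
  apply/eqP; rewrite -subr_eq0; apply/eqP.
  apply: (@roots_geq_poly_eq0 _ _ [seq x j | j <- enum 'I_N]).
  - apply/allP => _ /mapP[k _ ->].
    rewrite /root hornerD hornerN horner_sum (bigD1 k) //= hornerZ divfK //.
    rewrite big1 ?addr0 ?subrr // => j jk.
    have kj : k != j by rewrite eq_sym.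
    by rewrite hornerZ (lk _ _ kj) mulr0.
  - by rewrite map_inj_uniq ?enum_uniq.
  rewrite size_map size_enum_ord (leq_trans (size_polyD _ _)) //.
  by rewrite size_polyN geq_max sp sq.
rewrite {1}pq coef_sum; apply: eq_bigr => j _.
rewrite coefZ lj; have -> : (l j)`_N.-1 = lead_coef (l j).
  by rewrite lead_coefE sl.
by rewrite (eqP (monic_prod _ _)) ?mulr1 // => i _; exact: monicXsubC.
Qed.

(** In the Lagrange sum each of the [N + 1] denominators is at least [l^N (N + 1) / 2^N] by
    [cheb_nodes_prod], so the factor [N + 1] cancels the number of terms. *)
Lemma polya_discrete (R : realType) N (p : {poly R}) (x : 'I_N.+1 -> R) (M l : R) :
  0 < l -> (size p <= N.+1)%N -> (forall j, `|p.[x j]| <= M) ->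
  (forall i j : 'I_N.+1,
     l * `|cos (cheb_angle R N.+1 i) - cos (cheb_angle R N.+1 j)|
     <= `|x i - x j|) ->
  `|p`_N| * (l / 2) ^+ N <= M.
Proof.
move=> l0 sp pM xy.
have prodx j : l ^+ N * (N.+1%:R / 2 ^+ N) <=
    \prod_(i < N.+1 | i != j) `|x j - x i|.
  apply: (@le_trans _ _ (\prod_(i < N.+1 | i != j)
      (l * `|cos (cheb_angle R N.+1 j) - cos (cheb_angle R N.+1 i)|))).
    rewrite big_split /= prodr_const cardC1 card_ord /=.
    by rewrite ler_pM2l ?exprn_gt0 // cheb_nodes_prod.
  by apply: ler_prod => i _; rewrite xy andbT mulr_ge0 // ltW.
have low0 : 0 < l ^+ N * (N.+1%:R / 2 ^+ N).
  by rewrite mulr_gt0 ?divr_gt0 ?exprn_gt0 ?ltr0n.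
(* Coinciding points would make one of these products zero. *)
have xI : injective x.
  move=> i j xij; apply/eqP; apply: contraT => ij.
  have := lt_le_trans low0 (prodx j).
  by rewrite (bigD1 i) //= xij subrr normr0 mul0r ltxx.
have M0 : 0 <= M by exact: le_trans (normr_ge0 _) (pM ord0).
have -> := lead_coef_lagrange xI sp.
rewrite -ler_pdivlMr ?exprn_gt0 ?divr_gt0 //.
apply: le_trans (ler_norm_sum _ _ _) _.
apply: (@le_trans _ _ (\sum_(j < N.+1) M / (l ^+ N * (N.+1%:R / 2 ^+ N)))).
  apply: ler_sum => j _; rewrite normrM normfV normr_prod.
  rewrite ler_pM ?invr_ge0 ?prodr_ge0 // lef_pV2 // posrE //.
  exact: lt_le_trans low0 (prodx j).
rewrite sumr_const card_ord -[X in X <= _]mulr_natr expr_div_n.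
rewrite -mulrA ler_wpM2l // !invfM !invrK.
by rewrite -mulrA mulrAC mulVf ?mul1r // pnatr_eq0.
Qed.

(** * Polya's inequality *)

(** Cover [B] by half-open intervals of total length below [e]. [F] maps each into the interval
    around the image of its right endpoint whose radius is [k] times its length; hence the factor
    2. *)
Lemma lipschitz_image_measure_le (R : realType) (F : R -> R) (k e : R)
    (B Y : set R) :
  0 <= k -> (forall x y, `|F x - F y| <= k * `|x - y|) -> Y `<=` F @` B ->
  (lebesgue_measure B < e%:E)%E -> (lebesgue_measure Y <= (2 * k * e)%:E)%E.
Proof.
move=> k0 lipF YB /ereal_inf_lt[z [/= I [oI BI] sIz ze]].
(* For an empty [I n], [sup] and [inf] default to 0 and [J n] is a single point. *)
pose J n : set R :=
  `[F (sup (I n)) - k * (sup (I n) - inf (I n)),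
    F (sup (I n)) + k * (sup (I n) - inf (I n))]%classic.
have YJ : Y `<=` \bigcup_n J n.
  move=> y /YB [x /BI [n _ Inx] <-]; exists n => //; rewrite /J.
  have /ocitvP [I0|[[a b] /= ab Iab]] := oI n; first by rewrite I0 in Inx.
  move: Inx; rewrite Iab inf_itv ?bnd_simp // sup_itv ?bnd_simp //=.
  rewrite !in_itv /= => /andP[ax xb].
  have := lipF x b; rewrite ler_distl => /andP[l1 l2].
  have : k * `|x - b| <= k * (b - a).
    by rewrite ler_wpM2l // ler0_norm; lra.
  by move=> l3; apply/andP; split; lra.
have muJ n : (lebesgue_measure (J n) <= (2 * k)%:E * wlength idfun (I n))%E.
  rewrite /J; have /ocitvP [I0|[[a b] /= ab Iab]] := oI n.
    rewrite I0 inf0 sup0 subrr mulr0 subr0 addr0 wlength0 mule0.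
    by rewrite lebesgue_measure_itv /= ltxx.
  rewrite Iab inf_itv ?bnd_simp // sup_itv ?bnd_simp //.
  rewrite wlength_itv_bnd ?(ltW ab) //= lebesgue_measure_itv /= lte_fin.
  case: ifP => _; last by rewrite -EFinM lee_fin !mulr_ge0 // subr_ge0 ltW.
  by rewrite -EFinB -EFinM lee_fin; lra.
apply: (@le_trans _ _ (\sum_(n <oo) lebesgue_measure (J n))%E).
  apply: (le_trans _ (outer_measure_sigma_subadditive lebesgue_measure J)).
  exact: le_outer_measure.
apply: (@le_trans _ _ (\sum_(n <oo) ((2 * k)%:E * wlength idfun (I n)))%E).
  by apply: lee_nneseries => // n _ ; exact: measure_ge0.
rewrite nneseriesZl //.
rewrite [leRHS]EFinM; apply: lee_wpmul2l; first by rewrite lee_fin mulr_ge0.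
by apply: le_trans (ltW ze); rewrite -sIz.
Qed.

(** The measure of [K] up to [x] is nondecreasing and 1-Lipschitz in [x], so it takes the value [y];
    closedness of [K] then lets the point be chosen in [K]. *)
Lemma measure_quantile (R : realType) (K : set R) (a b y : R) :
  closed K -> K `<=` `[a, b] -> 0 < y -> (y%:E <= lebesgue_measure K)%E ->
  exists2 x, K x & lebesgue_measure (K `&` `[a, x]) = y%:E.
Proof.
move=> cK Kab y0 yK.
have mK : measurable K by exact: measurable_realfun.closed_measurable.
have ab : a <= b.
  rewrite leNgt; apply/negP => ba.
  move: yK; rewrite (_ : K = set0) ?measure0 ?leNgt ?lte_fin ?y0 //.
  rewrite -subset0 => x /Kab /=; rewrite in_itv /= => /andP[ax xb].
  by have := le_trans ax xb; lra.
have mI x : measurable (K `&` `[a, x]) by exact: measurableI.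
have fI x : lebesgue_measure (K `&` `[a, x]) \is a fin_num.
  rewrite ge0_fin_numE ?measure_ge0 //.
  apply: (@le_lt_trans _ _ (lebesgue_measure (`[a, b] : set R))).
    by apply: le_outer_measure => z [Kz _]; exact: Kab.
  by rewrite lebesgue_measure_itv /=; case: ifP; rewrite ?ltry // -EFinB ltry.
pose phi x := fine (lebesgue_measure (K `&` `[a, x])).
have phiE x : lebesgue_measure (K `&` `[a, x]) = (phi x)%:E by rewrite fineK.
have phi_mono u v : u <= v -> phi u <= phi v.
  move=> uv; rewrite -lee_fin -!phiE; apply: le_outer_measure.
  apply: setIS => z /=; rewrite !in_itv /= => /andP[-> zu]; exact: le_trans uv.
have phi_lip u v : u <= v -> phi v <= phi u + (v - u).
  move=> uv; rewrite -lee_fin EFinD -!phiE.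
  have -> : (v - u)%:E = lebesgue_measure (`]u, v] : set R).
    rewrite lebesgue_measure_itv /= lte_fin; case: ltP => [_|vu].
      by rewrite EFinB.
    by have -> : v = u by [apply/le_anti; rewrite uv vu]; rewrite subrr.
  apply: le_trans (outer_measureU2 lebesgue_measure _ _).
  apply: le_outer_measure.
  move=> z [Kz]; rewrite /= !in_itv /= => /andP[az zv].
  by case: (leP z u) => zu; [left; split; rewrite ?az|right; rewrite zv].
have phi_cont : continuous phi.
  move=> x; apply/cvgrPdist_le => e e0.
  near=> z; have zx : `|x - z| < e.
    by near: z; exact: (@nbhsx_ballx R R x e e0).
  apply: le_trans (ltW zx).
  case: (leP x z) => xz.
    have := phi_mono _ _ xz; have := phi_lip _ _ xz.
    by move=> h1 h2; rewrite !ler0_norm; lra.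
  have := phi_mono _ _ (ltW xz); have := phi_lip _ _ (ltW xz).
  by move=> h1 h2; rewrite !ger0_norm; lra.
have phia : phi a = 0.
  have : (lebesgue_measure (K `&` `[a, a]) <= lebesgue_measure [set a])%E.
    apply: le_outer_measure => z [_]; rewrite /= in_itv /= => zaa.
    exact/esym/le_anti.
  rewrite lebesgue_measure_set1 phiE lee_fin => h; apply/le_anti.
  by rewrite h fine_ge0.
have phib : y <= phi b.
  by rewrite -lee_fin -phiE; rewrite setIidl.
have [||xi xiab phixi] := @IVT _ phi a b y ab.
- by apply: continuous_subspaceT.
- by rewrite phia (min_idPl _) ?(max_idPr _); lra.
(* [xi] may fall in a gap of [K]; stepping back to the last point of [K] at or before it does not
   change the measure. *)
pose A := K `&` `[a, xi].
have A0 : A !=set0.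
  apply/set0P/negP => /eqP A0; move: (phiE xi); rewrite -/A A0 measure0 phixi.
  by move=> [] y00; rewrite -y00 ltxx in y0.
have Aub : has_ubound A.
  by exists xi => z [_]; rewrite /= in_itv /= => /andP[].
have cA : closed A by apply: closedI => //; exact: itv_closed.
have As : A (sup A).
  by rewrite {1}(closure_id A).1 //; exact: closure_sup.
exists (sup A); first by case: As.
rewrite -phixi -phiE; congr (lebesgue_measure _); apply/seteqP; split.
  move=> z [Kz]; rewrite /= !in_itv /= => /andP[az zs]; split => //=.
  rewrite az; apply: le_trans zs _.
  by case: As => _; rewrite /= in_itv /= => /andP[].
move=> z Az; have [Kz] := Az; rewrite /= !in_itv /= => /andP[az zs].
by split => //=; rewrite az; exact: sup_upper_bound.
Unshelve. all: by end_near. Qed.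

(* Transporting the Chebyshev nodes through the inverse of
   x |-> |K `&` [a, x]| moves them into K without bringing them closer. *)
Lemma polya_inequality (R : realType) N (p : {poly R}) (a b M L : R) :
  0 < L -> (size p <= N.+1)%N ->
  (L%:E <= lebesgue_measure [set x | x \in `[a, b] /\ (`|p.[x]| <= M)%R])%E ->
  `|p`_N| * (L / 4) ^+ N <= M.
Proof.
move=> L0 sp; set K := [set x | _] => LK.
have cK : closed K.
  have -> : K = `[a, b]%classic `&` (fun x => `|p.[x]|) @^-1` [set z | z <= M].
    by [].
  apply: closedI; first exact: itv_closed.
  apply: closed_comp => [x _|]; last exact: closed_le.
  by apply: (@continuous_comp _ _ _ (horner p)); 
    [exact: continuous_horner|exact: norm_continuous].
have Kab : K `<=` `[a, b] by move=> x [].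
(* The Chebyshev nodes carried affinely from [[-1, 1]] to [[0, L]], hence the spacing ratio [L / 2]
   below. *)
pose y j := L / 2 * (1 + cos (cheb_angle R N.+1 j)).
have yK (j : 'I_N.+1) :
    {x | K x & lebesgue_measure (K `&` `[a, x]) = (y j)%:E}.
  have [u0 u1] := andP (cheb_angle_itv R (ltn_ord j)).
  have hN1 : -1 < cos (cheb_angle R N.+1 j).
    by rewrite -cospi ltr_cos ?in_itv /= ?pi_ge0 ?lexx ?(ltW u0) ?(ltW u1).
  apply/cid2; apply: measure_quantile cK Kab _ _.
    by rewrite /y mulr_gt0 //; lra.
  apply: le_trans LK; rewrite lee_fin /y.
  by have := cos_le1 (cheb_angle R N.+1 j); nra.
pose x j := s2val (yK j).
have := @polya_discrete R N p x M (L / 2); rewrite -mulrA -invfM -natrM.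
apply => //; first by lra.
  by move=> j; have [] := s2valP (yK j).
suff xy i j : x j <= x i -> y i - y j <= x i - x j /\ 0 <= y i - y j.
  move=> i j; have e : `|y i - y j| = L / 2 *
      `|cos (cheb_angle R N.+1 i) - cos (cheb_angle R N.+1 j)|.
    have -> : y i - y j = L / 2 *
      (cos (cheb_angle R N.+1 i) - cos (cheb_angle R N.+1 j)).
      by rewrite /y; ring.
    by rewrite normrM gtr0_norm //; lra.
  rewrite -e; case: (leP (x j) (x i)) => xji.
    by have [? ?] := xy _ _ xji; rewrite !ger0_norm; lra.
  by have [? ?] := xy _ _ (ltW xji); rewrite !ler0_norm; lra.
move=> xij.
have mK : measurable K by exact: measurable_realfun.closed_measurable.
have yE l : lebesgue_measure (K `&` `[a, x l]) = (y l)%:E := s2valP' (yK l).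
split.
  (* [K] has measure [y i - y j] between the two points, which is at most the length of that
     interval. *)
  rewrite lerBlDr -lee_fin EFinD -!yE.
  have -> : (x i - x j)%:E = lebesgue_measure (`]x j, x i] : set R).
    rewrite lebesgue_measure_itv /= lte_fin; case: ltP => [_|vu].
      by rewrite EFinB.
    by have -> : x i = x j by [apply/le_anti; rewrite xij vu]; rewrite subrr.
  rewrite addeC.
  apply: le_trans (outer_measureU2 lebesgue_measure _ _).
  apply: le_outer_measure.
  move=> z [Kz]; rewrite /= !in_itv /= => /andP[az zv].
  by case: (leP z (x j)) => zu; [left; split; rewrite ?az|right; rewrite zv].
rewrite subr_ge0 -lee_fin -!yE; apply: le_outer_measure.
apply: setIS => z /=; rewrite !in_itv /= => /andP[-> zu]; exact: le_trans xij.
Qed.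

(** * Averaging over a fibre *)

Lemma cosD2npi (R : realType) (x : R) n : cos (x + 2 * pi * n%:R) = cos x.
Proof.
by rewrite -(periodicn (@cosD2pi R) n x); congr cos; rewrite -mulr_natr; ring.
Qed.

Lemma sinD2npi (R : realType) (x : R) n : sin (x + 2 * pi * n%:R) = sin x.
Proof.
by rewrite -(periodicn (@sinD2pi R) n x); congr sin; rewrite -mulr_natr; ring.
Qed.

Lemma cosD2zpi (R : realType) (x : R) (k : int) : cos (x + 2 * pi * k%:~R) = cos x.
Proof.
case: k => n; first by rewrite -pmulrn cosD2npi.
rewrite NegzE mulrNz -pmulrn -[LHS](cosD2npi _ n.+1); congr cos; ring.
Qed.

Lemma sinD2zpi (R : realType) (x : R) (k : int) : sin (x + 2 * pi * k%:~R) = sin x.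
Proof.
case: k => n; first by rewrite -pmulrn sinD2npi.
rewrite NegzE mulrNz -pmulrn -[LHS](sinD2npi _ n.+1); congr sin; ring.
Qed.

Lemma sin_rational_pi_neq0 (R : realType) (m l : nat) : (0 < m)%N ->
  ~~ (m %| l)%N -> sin (l%:R * pi / m%:R : R) != 0.
Proof.
move=> m0 ml; have m0' : (0 : R) < m%:R by rewrite ltr0n.
have r0 : (0 < l %% m)%N by rewrite lt0n.
have rm := ltn_pmod l m0.
have -> : l%:R * pi / m%:R = (l %/ m)%:R * pi + (l %% m)%:R * pi / m%:R :> R.
  rewrite {1}(divn_eq l m) natrD natrM; field.
  by rewrite lt0r_neq0.
rewrite sinD sin_natpi mul0r add0r cos_natpi mulf_neq0 ?signr_eq0 //.
rewrite lt0r_neq0 // sin_gt0_pi //; apply/andP; split.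
  by rewrite divr_gt0 // mulr_gt0 ?pi_gt0 // ltr0n.
by rewrite ltr_pdivrMr // mulrC ltr_pM2l ?pi_gt0 // ltr_nat.
Qed.

(** If [m] divides [l], all terms agree by periodicity. Otherwise multiplying by the nonzero number
    [2 sin (l pi / m)] makes the sum telescope. *)
Lemma sum_cos_equidistant (R : realType) (m l : nat) (s : R) : (0 < m)%N ->
  \sum_(j < m) cos (l%:R * (s + 2 * pi * j%:R / m%:R)) =
  if (m %| l)%N then m%:R * cos (l%:R * s) else 0.
Proof.
move=> m0; have m0' : (m%:R : R) != 0 by rewrite pnatr_eq0 -lt0n.
case: ifPn => [/dvdnP[q ->]|ml].
  rewrite (eq_bigr (fun=> cos ((q * m)%:R * s))).
    by rewrite sumr_const card_ord [RHS]mulr_natl.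
  move=> j _; rewrite -[RHS](cosD2npi _ (q * j)); congr cos.
  by rewrite !natrM; field.
set w : R := l%:R * pi / m%:R.
have w0 : 2 * sin w != 0 by rewrite mulf_neq0 // sin_rational_pi_neq0.
apply: (mulfI w0); rewrite mulr0 big_distrr /=.
pose g (j : nat) := sin (l%:R * s + w * (2 * j%:R - 1)).
rewrite (eq_bigr (fun j : 'I_m => g j.+1 - g j)).
  rewrite -(big_mkord xpredT (fun j => g j.+1 - g j)) telescope_sumr //.
  (* The two ends of the telescope differ by [l] full turns. *)
  rewrite /g -(sinD2npi (l%:R * s + w * (2 * 0%:R - 1)) l) /w.
  apply/eqP; rewrite subr_eq0; apply/eqP; congr sin; field.
  by [].
move=> j _; rewrite /g.
have -> : l%:R * (s + 2 * pi * j%:R / m%:R) = l%:R * s + w * (2 * j%:R).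
  by rewrite /w; field.
have -> : l%:R * s + w * (2 * j.+1%:R - 1) = (l%:R * s + w * (2 * j%:R)) + w.
  by rewrite -natr1; ring.
have -> : l%:R * s + w * (2 * j%:R - 1) = (l%:R * s + w * (2 * j%:R)) - w.
  by ring.
by rewrite sinD sinB; ring.
Qed.

Lemma cos_distn (R : realType) (k n : nat) (x : R) :
  cos (k%:R * x - n%:R * x) = cos (`|k - n|%N%:R * x).
Proof.
rewrite -mulrBl; case: (leqP n k) => nk.
  by rewrite distnEl // natrB.
by rewrite distnEr ?(ltnW nk) // natrB ?(ltnW nk) // -cosN -mulNr opprB.
Qed.

(* h = Re (e^{in(t-theta)} (1 - sum_k c_k e^{-ikt})) is bounded by
   |1 - sum_k c_k e^{-ikt}|, and its part even in t - theta is a cosine sum. *)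
Lemma trig_even_part (R : realType) (N n : nat) (c : 'I_N -> R * R) (theta : R) :
  exists a : 'I_N -> R, forall s M, 0 <= M ->
    trig_abs2 c (theta + s) <= M ^+ 2 -> trig_abs2 c (theta - s) <= M ^+ 2 ->
    `|cos (n%:R * s) - \sum_(k < N) a k * cos (`|k.+1 - n|%N%:R * s)| <= M.
Proof.
(* [a k] is the real part of [c_k e^{-i(k+1) theta}]. *)
exists (fun k => (c k).1 * cos (k.+1%:R * theta) + (c k).2 * sin (k.+1%:R * theta)).
move=> s M M0 Mp Mm.
pose A t := 1 - \sum_(k < N) ((c k).1 * cos (k.+1%:R * t) + (c k).2 * sin (k.+1%:R * t)).
pose B t := \sum_(k < N) ((c k).2 * cos (k.+1%:R * t) - (c k).1 * sin (k.+1%:R * t)).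
(* The trigonometric polynomial is [A - iB], and the left side is the real part of its product with
   [e^{ip}]; this is Cauchy-Schwarz. *)
have bound x p : A x ^+ 2 + B x ^+ 2 <= M ^+ 2 ->
    `|cos p * A x + sin p * B x| <= M.
  move=> AB; rewrite -(@ler_pXn2r _ 2) ?nnegrE // real_normK ?num_real //.
  apply: le_trans AB; rewrite -subr_ge0.
  have -> : A x ^+ 2 + B x ^+ 2 - (cos p * A x + sin p * B x) ^+ 2 =
     (sin p * A x - cos p * B x) ^+ 2
     + (1 - (cos p ^+ 2 + sin p ^+ 2)) * (A x ^+ 2 + B x ^+ 2) by ring.
  by rewrite cos2Dsin2 subrr mul0r addr0 sqr_ge0.
(* Opposite phases at the mirror points [theta + s] and [theta - s]; the mean of the two values is
   the even part. *)
have hp := bound _ (n%:R * s) Mp.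
have hm := bound _ (- (n%:R * s)) Mm.
have term t p : cos p * A t + sin p * B t = cos p - \sum_(k < N)
    ((c k).1 * cos (k.+1%:R * t - p) + (c k).2 * sin (k.+1%:R * t - p)).
  rewrite /A /B mulrBr mulr1 -addrA; congr (_ + _).
  rewrite !big_distrr /= -!sumrN -big_split /=; apply: eq_bigr => k _.
  by rewrite cosB sinB; ring.
rewrite !term cosN in hp hm.
have -> : cos (n%:R * s) - \sum_(k < N)
    ((c k).1 * cos (k.+1%:R * theta) + (c k).2 * sin (k.+1%:R * theta)) *
       cos (`|k.+1 - n|%N%:R * s) =
  ((cos (n%:R * s) - \sum_(k < N) ((c k).1 * cos (k.+1%:R * (theta + s) - n%:R * s) +
              (c k).2 * sin (k.+1%:R * (theta + s) - n%:R * s))) +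
  (cos (n%:R * s) - \sum_(k < N) ((c k).1 * cos (k.+1%:R * (theta - s) - - (n%:R * s)) +
              (c k).2 * sin (k.+1%:R * (theta - s) - - (n%:R * s))))) / 2.
  set S1 := \sum_(k < N) _; set S2 := \sum_(k < N) _; set S3 := \sum_(k < N) _.
  suff -> : S1 = (S2 + S3) / 2 by field.
  rewrite /S1 /S2 /S3 -big_split /= big_distrl /=; apply: eq_bigr => k _.
  rewrite -cos_distn.
  have -> : k.+1%:R * (theta + s) - n%:R * s =
    k.+1%:R * theta + (k.+1%:R * s - n%:R * s) by ring.
  have -> : k.+1%:R * (theta - s) - - (n%:R * s) =
    k.+1%:R * theta - (k.+1%:R * s - n%:R * s) by ring.
  by rewrite !(cosD, sinD, cosN, sinN); field.
rewrite normrM (@ger0_norm _ (2^-1)) ?invr_ge0 // ler_pdivrMr //.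
apply: le_trans (ler_normD _ _) _; lra.
Qed.

(** Since [N < 2mn], turning by [e^{imns}] leaves the frequencies [|k + 1 - mn|] below [mn], so only
    the constant term 1 contributes in degree [n]. Averaging over [m] equidistant angles keeps the
    multiples of [m], and such a frequency [l] becomes [T_(l/m)] at [cos u]. *)
Lemma trig_average_poly (R : realType) (m N n : nat) (c : 'I_N -> R * R)
    (theta : R) :
  (0 < m)%N -> (0 < n)%N -> (N < 2 * (m * n))%N ->
  exists q : {poly R}, [/\ (size q <= n.+1)%N, q`_n = 2 ^+ n.-1 &
    forall u M, 0 <= M ->
      (forall t, cos (m%:R * (t - theta)) = cos u -> trig_abs2 c t <= M ^+ 2) ->
      `|q.[cos u]| <= M].
Proof.
move=> m0 n0 Nn.
have m0' : (m%:R : R) != 0 by rewrite pnatr_eq0 -lt0n.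
have [a aP] := trig_even_part (m * n) c theta.
pose l (k : 'I_N) := `|k.+1 - (m * n)%N|%N.
have ln k : (l k < m * n)%N.
  by rewrite /l; have := ltn_ord k; rewrite -[(m * n)%N]/(m * n)%N; lia.
have lq k : (l k %/ m < n)%N by rewrite ltn_divLR // mulnC.
pose r := \sum_(k < N | (m %| l k)%N) a k *: chebT R (l k %/ m).
have sr : (size r <= n)%N.
  rewrite (leq_trans (size_sum _ _ _)) //; apply/bigmax_leqP => k _.
  by rewrite (leq_trans (size_scale_leq _ _)) // size_chebT.
exists (chebT R n - r); split.
- rewrite (leq_trans (size_polyD _ _)) // size_polyN size_chebT geq_max leqnn.
  by rewrite (leq_trans sr).
- rewrite coefB (nth_default _ sr) subr0 -(lead_coef_chebT R n) lead_coefE.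
  by rewrite size_chebT.
move=> u M M0 hM.
(* Modulo [2 pi], these are the [m] angles whose [m]-fold is [u]. *)
pose s j := u / m%:R + 2 * pi * j%:R / m%:R.
have avg (k : nat) : (m %| k)%N ->
    cos ((k %/ m)%:R * u) = (\sum_(j < m) cos (k%:R * s j)) / m%:R.
  move=> mk; rewrite sum_cos_equidistant // mk mulrAC mulfV // mul1r; congr cos.
  by rewrite -{2}(divnK mk) natrM; field.
have avg0 (k : nat) : ~~ (m %| k)%N -> \sum_(j < m) cos (k%:R * s j) = 0.
  by move=> mk; rewrite sum_cos_equidistant // (negbTE mk).
have -> : (chebT R n - r).[cos u] = (\sum_(j < m)
   (cos ((m * n)%:R * s j) - \sum_(k < N) a k * cos ((l k)%:R * s j))) / m%:R.
  rewrite hornerD hornerN chebT_cos sumrB mulrBl.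
  rewrite -{1}(mulKn n m0) avg ?dvdn_mulr //; congr (_ - _).
  rewrite exchange_big /= /r horner_sum big_mkcond big_distrl /=.
  apply: eq_bigr => k _; rewrite -big_distrr /=; case: ifPn => mk.
    by rewrite hornerZ chebT_cos avg // mulrA.
  by rewrite avg0 // mulr0 mul0r.
(* By evenness of the cosine, [theta + s j] and [theta - s j] both lie in the fibre over [cos u]. *)
have mcos j e : (e = 1 \/ e = -1) ->
  cos (m%:R * (theta + e * s j - theta)) = cos u.
  move=> he; have -> : m%:R * (theta + e * s j - theta) = e * (u + 2 * pi * j%:R).
    by rewrite /s; field.
  case: he => ->; first by rewrite mul1r cosD2npi.
  by rewrite mulN1r cosN cosD2npi.
rewrite normrM normfV normr_nat ler_pdivrMr ?ltr0n //.
apply: le_trans (ler_norm_sum _ _ _) _.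
rewrite -[X in _ * X%:R]card_ord mulr_natr -sumr_const; apply: ler_sum => j _.
apply: aP => //; apply: hM.
  by have := mcos j 1 (or_introl erefl); rewrite mul1r.
by have := mcos j (-1) (or_intror erefl); rewrite mulN1r.
Qed.

(** * Chebyshev polynomials on the circle *)

(* z^n * 2 b^n T_n((x - c) / b) with x = (z + 1/z) / 2 *)
Fixpoint circT (R : comNzRingType) (c b : R) (n : nat) : {poly R} :=
  match n with
  | 0 => 2%:P
  | n'.+1 => match n' with
             | 0 => 'X * 'X - (2 * c) *: 'X + 1
             | n''.+1 => 'X * ('X * circT c b n') - (2 * c) *: ('X * circT c b n')
                         + circT c b n' - b ^+ 2 *: ('X * ('X * circT c b n''))
             end
  end.

(** For [p] of size at most [K] this is the real part of [e^{i phi} p(e^{iv})]. The phase turns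
    multiplication by ['X] into a shift of [phi], and [phi = - pi / 2] gives the imaginary part. *)
Definition cos_sum (R : realType) (K : nat) (p : {poly R}) (v phi : R) : R :=
  \sum_(k < K) p`_k * cos (k%:R * v + phi).

Lemma cos_sumD (R : realType) K (p q : {poly R}) v phi :
  cos_sum K (p + q) v phi = cos_sum K p v phi + cos_sum K q v phi.
Proof.
by rewrite /cos_sum -big_split; apply: eq_bigr => k _; rewrite coefD mulrDl.
Qed.

Lemma cos_sumZ (R : realType) K a (p : {poly R}) v phi :
  cos_sum K (a *: p) v phi = a * cos_sum K p v phi.
Proof.
by rewrite /cos_sum big_distrr /=; apply: eq_bigr => k _; rewrite coefZ mulrA.
Qed.

Lemma cos_sumN (R : realType) K (p : {poly R}) v phi :
  cos_sum K (- p) v phi = - cos_sum K p v phi.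
Proof. by rewrite -scaleN1r cos_sumZ mulN1r. Qed.

Lemma cos_sumX (R : realType) K (p : {poly R}) v phi :
  cos_sum K.+1 ('X * p) v phi = cos_sum K p v (v + phi).
Proof.
rewrite /cos_sum big_ord_recl coefXM /= mul0r add0r; apply: eq_bigr => k _.
by rewrite coefXM /= -natr1; congr (_ * cos _); ring.
Qed.

(** At [z = e^{iv}] one has [z + 1/z = 2 (c + b cos w)], so the recursion of [circT] becomes that of
    [cosSS] for [cos (n w)]. The bound on [K] ensures that no coefficient is cut off. *)
Lemma cos_sum_circT (R : realType) (c b : R) n K v w phi :
  (2 * n < K)%N -> cos v - c = b * cos w ->
  cos_sum K (circT c b n) v phi = 2 * b ^+ n * cos (n%:R * w) * cos (n%:R * v + phi).
Proof.
move=> + vw; elim/nat_ind2: n K phi => [K phi|K phi|n IH0 IH1 K phi].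
- case: K => // K _; rewrite /cos_sum big_ord_recl big1 => [|k _].
    by rewrite coefC /= !mul0r add0r cos0; ring.
  by rewrite coefC /= mul0r.
- case: K => [|[|[|K]]] // _.
  have -> : circT c b 1 = 'X * ('X * 1) - (2 * c) *: ('X * 1) + 1.
    by rewrite !mulr1.
  rewrite !cos_sumD cos_sumN cos_sumZ !cos_sumX.
  have c1 K' x : cos_sum K'.+1 1 v x = cos x.
    rewrite /cos_sum big_ord_recl big1 => [|k _].
      by rewrite coef1 /= mul0r mul1r add0r addr0.
    by rewrite coef1 /= mul0r.
  rewrite !c1 expr1 !mul1r.
  have -> : c = cos v - b * cos w by rewrite -vw; ring.
  have -> : cos (v + (v + phi)) = cos (v + phi + v) by congr cos; ring.
  have -> : cos phi = cos (v + phi - v) by congr cos; ring.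
  by move: (v + phi) => x; rewrite cosD cosB; ring.
case: K => [|[|K]]; rewrite ?mulnS // => nK.
rewrite /= -/(circT c b n.+1) !cos_sumD !cos_sumN !cos_sumZ !cos_sumX.
rewrite !IH1 ?IH0; try lia.
rewrite cosSS.
have -> : c = cos v - b * cos w by rewrite -vw; ring.
set x := n.+1%:R * v + (v + phi).
have -> : n.+1%:R * v + (v + (v + phi)) = x + v by rewrite /x; ring.
have -> : n.+1%:R * v + phi = x - v by rewrite /x; ring.
have -> : n%:R * v + (v + (v + phi)) = x by rewrite /x -natr1; ring.
have -> : n.+2%:R * v + phi = x by rewrite /x -(natr1 n.+1); ring.
by rewrite cosD cosB !exprS; ring.
Qed.

Lemma size_circT (R : comNzRingType) (c b : R) n :
  (size (circT c b n) <= (2 * n).+1)%N.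
Proof.
apply/leq_sizeP; elim/nat_ind2: n => [||n IH0 IH1] k nk.
- by rewrite coefC; case: k nk.
- case: k nk => [|[|[|k]]] // _.
  by rewrite /= !coefD coefN coefZ coefXM coefX coefX coef1 /= mulr0 subr0 addr0.
case: k nk => [|[|k]]; rewrite ?mulnS // => nk.
rewrite /= -/(circT c b n.+1) !coefD !coefN !coefZ !coefXM /=.
by rewrite !IH1 ?IH0; [ring|lia..].
Qed.

(** All but one term of the recursion carry a factor ['X], so the constant term is inherited. The
    index starts at 1 because [circT c b 0] is 2. *)
Lemma circT_coef0 (R : comNzRingType) (c b : R) n : (circT c b n.+1)`_0 = 1.
Proof.
elim: n => [|n IH].
  by rewrite /= !coefD coefN coefZ coefXM coefX coef1 /= mulr0 subr0 add0r.
rewrite /= -/(circT c b n.+1) !coefD !coefN !coefZ !coefXM /= IH; ring.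
Qed.

(** The [d] are chosen so that [1 - sum_k d_k e^{-ikt}] is [circT] at [z = e^{-im(t - theta)}]. Its
    modulus is [2 b^N |T_N|] at a point of [[-1, 1]], where [|T_N| <= 1]. *)
Lemma trig_abs2_chebyshev (R : realType) (m N n : nat) (c b theta : R) :
  (0 < m)%N -> (0 < N)%N -> (m * (2 * N) <= n)%N -> 0 < b ->
  exists d : 'I_n -> R * R, forall t, `|cos (m%:R * (t - theta)) - c| <= b ->
    trig_abs2 d t <= 4 * b ^+ (2 * N).
Proof.
move=> m0 N0 Nn b0.
pose D := circT c b N; pose K := (2 * N).+1.
(* At most one [j] satisfies [k + 1 = m j]: this is the coefficient of [circT] landing on frequency
   [k + 1], or 0. *)
pose e (k : 'I_n) := \sum_(j < K | k.+1 == (m * j)%N :> nat) D`_j.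
(* [d_k = - e_k e^{i(k+1) theta}]: the sign offsets the minus in [1 - sum], the rotation recentres
   at [theta]. *)
exists (fun k => (- e k * cos (k.+1%:R * theta), - e k * sin (k.+1%:R * theta))).
move=> t tb; pose v := m%:R * (t - theta).
have reindex_sum (g : R -> R) : \sum_(k < n) e k * g (k.+1%:R * (t - theta)) =
    \sum_(j < 2 * N) D`_j.+1 * g (j.+1%:R * v).
  under eq_bigr => k _ do rewrite /e big_distrl big_mkcond big_ord_recl /= muln0 /= add0r.
  rewrite exchange_big /=; apply: eq_bigr => j _.
  have jn : ((m * j.+1).-1 < n)%N.
    by have := ltn_ord j; nia.
  rewrite (bigD1 (Ordinal jn)) //= big1 => [|k].
    rewrite prednK ?muln_gt0 ?m0 // eqxx addr0.
    by congr (_ * g _); rewrite /v natrM; ring.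
  move=> kn; case: ifPn => // /eqP kj; case/eqP: kn; apply/val_inj => /=.
  by rewrite -[bump 0 j]/(j.+1) in kj; rewrite -kj.
have D0 : D`_0 = 1 by rewrite /D; case: (N) N0 => // N' _; exact: circT_coef0.
have -> : trig_abs2 (fun k : 'I_n =>
    (- e k * cos (k.+1%:R * theta), - e k * sin (k.+1%:R * theta))) t =
  cos_sum K D v 0 ^+ 2 + cos_sum K D v (- (pi / 2)) ^+ 2.
  rewrite /trig_abs2 /=; congr (_ ^+ 2 + _ ^+ 2).
    rewrite /cos_sum big_ord_recl D0 mul0r addr0 cos0 mulr1 -sumrN; congr (_ + _).
    under [RHS]eq_bigr => j _ do rewrite addr0.
    rewrite -(reindex_sum cos); apply: eq_bigr => k _.
    by rewrite mulrBr cosB; ring.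
  rewrite /cos_sum big_ord_recl D0 mul0r add0r cosN cos_pihalf mulr0 add0r.
  under [RHS]eq_bigr => j _ do rewrite cosBpihalf.
  rewrite -(reindex_sum sin); apply: eq_bigr => k _.
  by rewrite mulrBr sinB; ring.
have cb : -1 <= (cos v - c) / b <= 1.
  rewrite -ler_norml normrM normfV (gtr0_norm b0) ler_pdivrMr // mul1r.
  exact: tb.
have vw : cos v - c = b * cos (acos ((cos v - c) / b)).
  by rewrite acosK ?in_itv //= mulrC divfK // lt0r_neq0.
rewrite !(cos_sum_circT _ _ vw) ?ltnS // addr0 cosBpihalf.
set x := cos (N%:R * acos _).
have -> : (2 * b ^+ N * x * cos (N%:R * v)) ^+ 2 + (2 * b ^+ N * x * sin (N%:R * v)) ^+ 2
  = 4 * (b ^+ N) ^+ 2 * x ^+ 2 * (cos (N%:R * v) ^+ 2 + sin (N%:R * v) ^+ 2) by ring.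
rewrite cos2Dsin2 mulr1 -exprM mulnC ler_piMr ?mulr_ge0 ?exprn_ge0 ?(ltW b0) //.
by rewrite -[leRHS](cos2Dsin2 (N%:R * acos ((cos v - c) / b))) lerDl sqr_ge0.
Qed.

(** * The lower bound *)

Lemma cos_lipschitz (R : realType) (x y : R) : `|cos x - cos y| <= `|x - y|.
Proof.
wlog xy : x y / x <= y.
  move=> H; case: (leP x y) => [|/ltW] /H //.
  by rewrite distrC [leRHS]distrC.
have [z _ e] : exists2 z, z \in `[x, y] & cos y - cos x = - sin z * (y - x).
  apply: (MVT_segment (df := fun z => - sin z)) => //.
  by apply: continuous_subspaceT; exact: continuous_cos.
by rewrite distrC e normrM normrN [leRHS]distrC ler_piMl // sin_max.
Qed.

Lemma trig_abs2_ge0 (R : realType) n (c : 'I_n -> R * R) t : 0 <= trig_abs2 c t.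
Proof. by rewrite /trig_abs2 addr_ge0 ?sqr_ge0. Qed.

Lemma measurable_trig_abs2 (R : realType) n (c : 'I_n -> R * R) D :
  measurable_fun D (trig_abs2 c).
Proof.
have mc (k : 'I_n) : measurable_fun D (fun x : R => cos (k.+1%:R * x)).
  apply: measurableT_comp; last exact: measurable_funM.
  by apply: continuous_measurable_fun; exact: continuous_cos.
have ms (k : 'I_n) : measurable_fun D (fun x : R => sin (k.+1%:R * x)).
  apply: measurableT_comp; last exact: measurable_funM.
  by apply: continuous_measurable_fun; exact: continuous_sin.
apply: measurable_funD; apply: measurable_funX.
  apply: measurable_funB => //; apply: measurable_sum => k.
  by apply: measurable_funD; exact: measurable_funM.
apply: measurable_sum => k.
by apply: measurable_funB; exact: measurable_funM.
Qed.

Lemma trig_abs2_periodic (R : realType) n (c : 'I_n -> R * R) t (z : int) :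
  trig_abs2 c (t + 2 * pi * z%:~R) = trig_abs2 c t.
Proof.
have e (k : 'I_n) : k.+1%:R * (t + 2 * pi * z%:~R) =
    k.+1%:R * t + 2 * pi * (k.+1%:Z * z)%:~R.
  by rewrite intrM -pmulrn; ring.
rewrite /trig_abs2; congr ((1 - _) ^+ 2 + _ ^+ 2); apply: eq_bigr => k _;
  by rewrite e cosD2zpi sinD2zpi.
Qed.

Lemma angle_reduce (R : realType) (t : R) :
  exists z : int, - pi <= t + 2 * pi * z%:~R < pi.
Proof.
have p0 := pi_gt0 R.
exists (- Num.floor ((t + pi) / (2 * pi))).
have := floor_le ((t + pi) / (2 * pi)); have := lt_succ_floor ((t + pi) / (2 * pi)).
rewrite intrD mulrNz; set z := _%:~R.
rewrite ltr_pdivrMr ?ler_pdivlMr ?mulr_gt0 // => h1 h2.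
by apply/andP; split; lra.
Qed.

(** The sets where [f <= 1 / (n + 1)] decrease to a null set within finite measure, so their
    measures tend to 0. *)
Lemma measure_sublevel_small (R : realType) (D : set R) (f : R -> R) (e : R) :
  measurable D -> (lebesgue_measure D < +oo)%E -> measurable_fun D f ->
  lebesgue_measure.-negligible [set x | D x /\ f x <= 0] -> 0 < e ->
  exists2 eta, 0 < eta & (lebesgue_measure [set x | D x /\ (f x <= eta)%R] < e%:E)%E.
Proof.
move=> mD fD mf neg e0.
pose B (n : nat) := D `&` [set x | f x <= n.+1%:R^-1].
have mB n : measurable (B n) by exact: measurable_fun_le.
have B0 : \bigcap_n B n = D `&` [set x | f x <= 0].
  apply/seteqP; split => [x Bx|x [Dx fx] n _]; last first.
    by split => //=; rewrite (le_trans fx).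
  split; first by have [] := Bx 0%N I.
  rewrite /= leNgt; apply/negP => fx.
  have [n] := ltr_add_invr fx; rewrite add0r ltNge => /negP; apply.
  by have [] := Bx n I.
have muB0 : lebesgue_measure (\bigcap_n B n) = 0%E.
  by apply: measure_negligible; rewrite B0 //; exact: measurable_fun_le.
apply: contrapT => H.
have eB n : (e%:E <= lebesgue_measure (B n))%E.
  rewrite leNgt; apply/negP => h; apply: H; exists n.+1%:R^-1 => //.
have cB : lebesgue_measure (B n) @[n --> \oo] --> 0%E.
  rewrite -muB0; apply: nonincreasing_cvg_mu => //.
  - by apply: le_lt_trans fD; apply: le_outer_measure => x [].
  - by apply: bigcapT_measurable.
  move=> p q pq; apply/subsetPset => x [Dx /= fx]; split => //=.
  by apply: le_trans fx _; rewrite lef_pV2 ?posrE // ler_nat.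
have : (e%:E <= lim (lebesgue_measure (B n) @[n --> \oo]))%E.
  apply: lime_ge; first by apply/cvg_ex; exists 0%E.
  by apply: nearW.
by rewrite (cvg_lim _ cB) // lee_fin leNgt e0.
Qed.

Section LowerBound.
Variables (R : realType) (f : R -> R) (m : nat) (theta a b : R).
Hypotheses (f_density : spectral_density f)
  (f_pos : {ae lebesgue_measure, forall x : R,
     Lam x -> clEf f (ei x) -> 0 < f x})
  (m_gt0 : (0 < m)%N) (aN1 : -1 <= a) (b1 : b <= 1)
  (E_cos : forall t, Lam t -> a <= cos (m%:R * (t - theta)) <= b ->
     clEf f (ei t)).

Let F (t : R) := cos (m%:R * (t - theta)).
Let D : set R := Lam (R := R) `&` [set t | a <= F t <= b].

Let mLam : measurable (Lam (R := R)).
Proof. exact: measurable_itv. Qed.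

Let F_lip x y : `|F x - F y| <= m%:R * `|x - y|.
Proof.
apply: le_trans (cos_lipschitz _ _) _.
have -> : m%:R * (x - theta) - m%:R * (y - theta) = m%:R * (x - y) by ring.
by rewrite normrM normr_nat.
Qed.

Let mF : measurable_fun setT F.
Proof.
apply: measurableT_comp.
  by apply: continuous_measurable_fun; exact: continuous_cos.
by apply: measurable_funM => //; exact: measurable_funB.
Qed.

Let mD : measurable D.
Proof.
have -> : D = (Lam (R := R) `&` [set t | a <= F t]) `&` [set t | F t <= b].
  apply/seteqP; split => t; rewrite /D /=; first by move=> [? /andP[]].
  by move=> [[? ->] ->].
have mF' A : measurable_fun A F by exact: measurable_funS mF.
by apply: measurable_fun_le => //; exact: measurable_fun_le.
Qed.

Let mf : measurable_fun (Lam (R := R)) f.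
Proof.
by have [_ [/measurable_int/measurable_EFinP]] := f_density.
Qed.

Let D_fin : (lebesgue_measure D < +oo)%E.
Proof.
apply: (@le_lt_trans _ _ (lebesgue_measure (Lam (R := R)))).
  by apply: le_outer_measure => x [].
by rewrite lebesgue_measure_itv /=; case: ifP; rewrite ?ltry // -EFinB ltry.
Qed.

Let sublevel_small e : 0 < e ->
  exists2 eta, 0 < eta & (lebesgue_measure [set x | D x /\ (f x <= eta)%R] < e%:E)%E.
Proof.
move=> e0; apply: measure_sublevel_small => //.
  by apply: measurable_funS mf => //; apply: subIsetl.
apply: negligibleS f_pos => t [[Lt Ft] f0] /= H.
by have := H Lt (E_cos Lt Ft); rewrite ltNge f0.
Qed.

(** By contradiction: if the integral were smaller, the image under [F] of the exceptional set
    [B1 \cup B2] would take at most [b - a - L] from [[a, b]]. On the rest [|q| <= M], against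
    Polya's inequality. *)
Lemma integral_trig_ge L : 0 < L < b - a ->
  exists2 C, 0 < C & forall N n (c : 'I_N -> R * R), (0 < n)%N ->
    (N < 2 * (m * n))%N ->
    ((C * (L / 2) ^+ (2 * n))%:E <=
     \int[lebesgue_measure]_(x in Lam (R := R)) (trig_abs2 c x * f x)%:E)%E.
Proof.
move=> /andP[L0 Lab].
have m0 : (0 : R) < m%:R by rewrite ltr0n.
(* Gives [4 m e = b - a - L]: the Lipschitz constant [m], the factor 2 of the image estimate, and
   two exceptional sets of measure below [e]. *)
pose e := (b - a - L) / (4 * m%:R).
have e0 : 0 < e by rewrite divr_gt0 ?mulr_gt0 // subr_gt0.
have [eta eta0 muB1] := sublevel_small e0.
exists (eta * e / 16) => [|N n c n0 Nn]; first by have := mulr_gt0 eta0 e0; lra.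
have [q [sq lq qP]] := trig_average_poly c theta m_gt0 n0 Nn.
(* Half of the value [(L / 2)^n / 2] that Polya's inequality forces for the leading coefficient
   [2^(n-1)]. *)
have [M ME] : exists M, M = (L / 2) ^+ n / 4 by exists ((L / 2) ^+ n / 4).
have M0 : 0 < M by rewrite ME divr_gt0 // exprn_gt0 // divr_gt0.
have -> : eta * e / 16 * (L / 2) ^+ (2 * n) = eta * M ^+ 2 * e.
  by rewrite mulnC exprM ME; field.
rewrite leNgt; apply/negP => Ilt.
pose B1 : set R := [set x | D x /\ f x <= eta].
pose B2 : set R := (D `&` [set x | eta <= f x]) `&` [set x | M ^+ 2 <= trig_abs2 c x].
have mfD : measurable_fun D f by apply: measurable_funS mf => //; apply: subIsetl.
have mB2 : measurable B2.
  apply: measurable_fun_le => //; first exact: measurable_fun_le.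
  exact: measurable_trig_abs2.
have mg : measurable_fun (Lam (R := R)) (fun x => (trig_abs2 c x * f x)%:E).
  apply/measurable_EFinP; apply: measurable_funM => //.
  exact: measurable_trig_abs2.
have f0 x : Lam x -> 0 <= f x by case: f_density => + _; apply.
(* Markov's inequality: the integrand is at least [eta M^2] on [B2]. *)
have muB2 : (lebesgue_measure B2 < e%:E)%E.
  rewrite -(@lte_pmul2l _ (eta * M ^+ 2)%:E) ?lte_fin ?mulr_gt0 ?exprn_gt0 //.
  rewrite -EFinM; apply: le_lt_trans Ilt.
  rewrite -(integral_cst lebesgue_measure mB2).
  apply: (@le_trans _ _ (\int[lebesgue_measure]_(x in B2) (trig_abs2 c x * f x)%:E)%E).
    apply: ge0_le_integral => //.
    - by move=> x _; rewrite lee_fin mulr_ge0 ?exprn_ge0 ?(ltW eta0) ?(ltW M0).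
    - by apply: measurable_funS mg => // x [[[]]].
    - move=> x [[_ /= fx] /= tx]; rewrite lee_fin mulrC ler_pM ?exprn_ge0 //.
        exact: ltW.
      exact: ltW.
  apply: ge0_subset_integral => //.
  - by move=> x Lx; rewrite lee_fin mulr_ge0 ?trig_abs2_ge0 ?f0.
  - by move=> x [[[]]].
have muB : (lebesgue_measure (B1 `|` B2) < (2 * e)%:E)%E.
  apply: le_lt_trans (outer_measureU2 lebesgue_measure _ _) _.
  by rewrite mulr_natl mulr2n EFinD; apply: lteD.
pose Y : set R := `[a, b]%classic `&` [set x | M < `|q.[x]|].
have YB : Y `<=` F @` (B1 `|` B2).
  move=> x [xab /= Mq]; have := xab; rewrite /= in_itv /= => /andP[ax xb].
  have x1 : x \in `[-1, 1] by rewrite in_itv /= (le_trans aN1) // (le_trans xb).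
  apply: contrapT => nFB; move: Mq; rewrite ltNge => /negP; apply.
  rewrite -(acosK x1); apply: qP => [|t]; first exact: ltW.
  rewrite acosK // => Ft; rewrite leNgt; apply/negP => Mt; apply: nFB.
  (* [f] is controlled only on [Lam], so [t] is moved there; [F] and [trig_abs2 c] have period
     [2 pi]. *)
  have [z /andP[z1 z2]] := angle_reduce t.
  have FE : F (t + 2 * pi * z%:~R) = x.
    rewrite /F -Ft -[RHS](cosD2zpi _ (m%:Z * z)); congr cos.
    by rewrite intrM -pmulrn; ring.
  exists (t + 2 * pi * z%:~R) => //.
  have Dt : D (t + 2 * pi * z%:~R).
    by split; rewrite /= ?FE ?ax // /Lam /= in_itv /= z1 ltW.
  case: (leP (f (t + 2 * pi * z%:~R)) eta) => ft; [left|right] => //.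
  by split => /=; [split => //=; exact: ltW|rewrite trig_abs2_periodic ltW].
have muY : (lebesgue_measure Y <= (b - a - L)%:E)%E.
  have := lipschitz_image_measure_le (ltW m0) F_lip YB muB.
  congr (_ <= _%:E)%E; rewrite /e; field; exact: lt0r_neq0.
have KL : (L%:E <= lebesgue_measure [set x | x \in `[a, b] /\ (`|q.[x]| <= M)%R])%E.
  have : (lebesgue_measure (`[a, b] : set R) <=
     lebesgue_measure [set x | x \in `[a, b] /\ (`|q.[x]| <= M)%R] +
     lebesgue_measure Y)%E.
    apply: le_trans (outer_measureU2 lebesgue_measure _ _).
    apply: le_outer_measure => x xab.
    by case: (leP `|q.[x]| M) => h; [left|right].
  rewrite lebesgue_measure_itv /= lte_fin ifT; last by lra.
  move=> h; have := le_trans h (leeD2l _ muY).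
  rewrite -EFinB -leeBlDr // -EFinB; congr (_%:E <= _)%E; ring.
have := polya_inequality L0 sq KL.
rewrite lq gtr0_norm ?exprn_gt0 // leNgt => /negP; apply.
rewrite ME -[X in 2 ^+ X.-1 * _](prednK n0) /=.
have -> : 2 ^+ n.-1 * (L / 4) ^+ n = (L / 2) ^+ n / 2.
  rewrite -{2 3}(prednK n0) !exprS !expr_div_n.
  have -> : (4 : R) = 2 * 2 by ring.
  have h2 : (2 : R) ^+ n.-1 != 0 by rewrite expf_neq0.
  by rewrite exprMn; field.
have : 0 < (L / 2) ^+ n by rewrite exprn_gt0 // divr_gt0.
lra.
Qed.

End LowerBound.

(** * The n-th root limit *)

Lemma sigma2_le_chebyshev (R : realType) (f : R -> R) (m : nat) (theta a b : R) :
  spectral_density f -> (0 < m)%N -> a < b ->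
  (forall t, Lam t -> 0 < f t -> a <= cos (m%:R * (t - theta)) <= b) ->
  exists2 C, 0 < C & forall n N, (0 < N)%N -> (m * (2 * N) <= n)%N ->
    (sigma2 n f <= (C * ((b - a) / 2) ^+ (2 * N))%:E)%E.
Proof.
move=> [f0 [fint _]] m0 ab E_cos.
have mLam : measurable (Lam (R := R)) by exact: measurable_itv.
have mf : measurable_fun (Lam (R := R)) f.
  by move/measurable_int/measurable_EFinP : fint.
have If : (\int[lebesgue_measure]_(x in Lam (R := R)) (f x)%:E)%E \is a fin_num.
  exact: integrable_fin_num.
have I0 : (0 <= \int[lebesgue_measure]_(x in Lam (R := R)) (f x)%:E)%E.
  by apply: integral_ge0 => x Lx; rewrite lee_fin f0.
pose J := fine (\int[lebesgue_measure]_(x in Lam (R := R)) (f x)%:E)%E.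
have J0 : 0 <= J by exact: fine_ge0.
have be0 : 0 < (b - a) / 2 by rewrite divr_gt0 // subr_gt0.
exists (4 * J + 1) => [|n N N0 Nn]; first by lra.
have [d dP] := trig_abs2_chebyshev ((a + b) / 2) theta m0 N0 Nn be0.
set B := ((b - a) / 2) ^+ (2 * N).
have B0 : 0 < B by exact: exprn_gt0.
apply: (@le_trans _ _ (\int[lebesgue_measure]_(x in Lam (R := R)) (trig_abs2 d x * f x)%:E)%E).
  by apply: ereal_inf_lbound; exists d.
apply: (@le_trans _ _ (\int[lebesgue_measure]_(x in Lam (R := R)) ((4 * B)%:E * (f x)%:E))%E).
  apply: ge0_le_integral => //.
  - by move=> x Lx; rewrite lee_fin mulr_ge0 ?trig_abs2_ge0 ?f0.
  - apply/measurable_EFinP; apply: measurable_funM; last exact: mf.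
    exact: measurable_trig_abs2.
  - by apply/measurable_EFinP; apply: measurable_funM.
  move=> x Lx; rewrite -EFinM lee_fin.
  (* Where [f] vanishes both sides are 0, so the bound on [d] is needed only where [f > 0]. *)
  have := f0 x Lx; rewrite le_eqVlt => /orP[/eqP <-|fx]; first by rewrite !mulr0.
  rewrite ler_pM2r //; apply: dP.
  by have /andP[h1 h2] := E_cos x Lx fx; rewrite ler_norml; apply/andP; split; lra.
have B4 : (0 <= (4 * B)%:E)%E by rewrite lee_fin; lra.
rewrite (@ge0_integralZl _ _ R lebesgue_measure _ mLam (EFin \o f)) //; last first.
  exact/measurable_EFinP.
rewrite -(fineK If) -EFinM lee_fin -/J; nra.
Qed.

Lemma powR_inv_nat_cvg1 (R : realType) (C : R) : 0 < C ->
  (fun n : nat => C `^ (n%:R^-1)) @ \oo --> (1 : R).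
Proof.
move=> C0; have -> : (fun n : nat => C `^ (n%:R^-1)) =
    expR \o (fun n : nat => n%:R^-1 * ln C).
  by apply/funext => n; rewrite /powR gt_eqF.
rewrite [X in _ --> X](_ : _ = expR (0 * ln C)); last by rewrite mul0r expR0.
apply: continuous_cvg; first exact: continuous_expR.
apply: cvgM; last exact: cvg_cst.
rewrite -cvg_shiftS; exact: cvg_harmonic.
Qed.

(** Constant factors disappear under the [n]-th root, so the lower constant may depend on [s]. *)
Lemma nth_root_cvg (R : realType) (u : nat -> R) (p : nat) (rho : R) :
  0 < rho -> (forall n, 0 <= u n) ->
  (exists2 C, 0 < C & forall n, (p <= n)%N -> u n <= C * rho ^+ n) ->
  (forall s, 0 < s < rho ->
     exists2 C, 0 < C & forall n, (p <= n)%N -> C * s ^+ n <= u n) ->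
  (fun n : nat => u n `^ (n%:R^-1)) @ \oo --> rho.
Proof.
move=> rho0 u0 [C C0 uC] low.
apply/cvgrPdist_le => e e0.
(* Within [e] of [rho], and still positive when [e] exceeds [rho]. *)
pose s := rho - Num.min e rho / 2.
have [se s1 s0] : [/\ rho - e < s, s < rho & 0 < s].
  by rewrite /s; case: (leP e rho) => ?; split; lra.
have [c c0 uc] : exists2 c, 0 < c & forall n, (p <= n)%N -> c * s ^+ n <= u n.
  by apply: low; rewrite s0 s1.
have root (x y : R) n : 0 < x -> 0 < y -> (0 < n)%N ->
    (x * y ^+ n) `^ (n%:R^-1) = x `^ (n%:R^-1) * y.
  move=> x0 y0 n0; rewrite powRM ?exprn_ge0 ?ltW //; congr (_ * _).
  by rewrite -powR_mulrn ?ltW // -powRrM mulfV ?powRr1 ?ltW // pnatr_eq0 -lt0n.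
near=> n.
have n0 : (0 < n)%N by near: n; exact: nbhs_infty_gt.
have pn : (p <= n)%N by near: n; exact: nbhs_infty_ge.
have ni : 0 <= (n%:R : R)^-1 by rewrite invr_ge0.
have up : u n `^ (n%:R^-1) <= C `^ (n%:R^-1) * rho.
  rewrite -root //; apply: ge0_ler_powR => //; last exact: uC.
    by rewrite nnegrE.
  by rewrite nnegrE mulr_ge0 ?exprn_ge0 ?ltW.
have lo : c `^ (n%:R^-1) * s <= u n `^ (n%:R^-1).
  rewrite -root //; apply: ge0_ler_powR => //; last exact: uc.
    by rewrite nnegrE mulr_ge0 ?exprn_ge0 ?ltW.
  by rewrite nnegrE.
have C1 : C `^ (n%:R^-1) * rho < rho + e.
  near: n; apply: (@cvgr_lt _ _ _ _ _ rho); last by rewrite ltrDl.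
  rewrite -[X in _ --> X]mul1r; apply: cvgM; last exact: cvg_cst.
  exact: powR_inv_nat_cvg1.
have c1 : rho - e < c `^ (n%:R^-1) * s.
  near: n; apply: (@cvgr_gt _ _ _ _ _ s) => //.
  rewrite -[X in _ --> X]mul1r; apply: cvgM; last exact: cvg_cst.
  exact: powR_inv_nat_cvg1.
by rewrite ler_norml; apply/andP; split; lra.
Unshelve. all: by end_near. Qed.

(** With [p = 2m], the upper bound rounds [n] down to a multiple of [p] and the lower bound rounds
    it up; either rounding costs only a constant factor. *)
Lemma sigma_root_cvg (R : realType) (f : R -> R) (m : nat) (theta a b : R) :
  spectral_density f ->
  {ae lebesgue_measure, forall x : R, Lam x -> clEf f (ei x) -> 0 < f x} ->
  (0 < m)%N -> -1 <= a -> a < b -> b <= 1 ->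
  (forall t, clEf f (ei t) <-> a <= cos (m%:R * (t - theta)) <= b) ->
  (fun n : nat => sigma n f `^ (n%:R^-1)) @ \oo -->
    ((b - a) / 2) `^ ((2 * m)%:R^-1).
Proof.
move=> fS fae m0 a1 ab b1 E_cos.
have m2 : (0 < 2 * m)%N by rewrite muln_gt0.
pose p := (2 * m)%N; pose be := (b - a) / 2.
have be0 : 0 < be by rewrite divr_gt0 // subr_gt0.
have be1 : be <= 1 by rewrite /be; lra.
pose rho := be `^ (p%:R^-1).
have rho0 : 0 < rho by exact: powR_gt0.
have rhop : rho ^+ p = be.
  rewrite -powR_mulrn ?powR_ge0 // -powRrM mulVf ?powRr1 ?ltW //.
  by rewrite pnatr_eq0 -lt0n.
have rho1 : rho <= 1.
  by rewrite -(@expr_le1 _ p) ?powR_ge0 // rhop.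
have E1 t : Lam t -> 0 < f t -> a <= cos (m%:R * (t - theta)) <= b.
  by move=> Lt ft; apply/E_cos/subset_closure; exists t.
have E2 t : Lam t -> a <= cos (m%:R * (t - theta)) <= b -> clEf f (ei t).
  by move=> _ /E_cos.
have s2_ge0 n : (0 <= sigma2 n f)%E.
  apply: le_ereal_inf_tmp => _ [c _ <-]; apply: integral_ge0 => x Lx.
  by rewrite lee_fin mulr_ge0 ?trig_abs2_ge0 //; case: fS => + _; apply.
have [C C0 upC] := sigma2_le_chebyshev fS m0 ab E1.
have divp n : (n < p * (n %/ p).+1)%N by rewrite mulnC ltn_ceil.
have divp' n : (p * (n %/ p) <= n)%N by rewrite mulnC leq_divM.
have up n : (p <= n)%N -> (sigma2 n f <= (C * be ^+ (2 * (n %/ p)))%:E)%E.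
  move=> pn; apply: upC; first by rewrite divn_gt0.
  by rewrite mulnA (mulnC m).
(* From [p] on the infimum is known to be finite, so [fine] returns it rather than a default. *)
have s2_fin n : (p <= n)%N -> sigma2 n f \is a fin_num.
  move=> pn; rewrite ge0_fin_numE //; apply: le_lt_trans (up n pn) _.
  by rewrite ltry.
apply: (nth_root_cvg (p := p)) => //.
- by move=> n; exact: sqrtr_ge0.
- exists (Num.sqrt C / be) => [|n pn]; first by rewrite divr_gt0 // sqrtr_gt0.
  apply: (@le_trans _ _ (Num.sqrt C * be ^+ (n %/ p))).
    rewrite -(ger0_norm (exprn_ge0 (n %/ p) (ltW be0))) -sqrtr_sqr.
    rewrite -(sqrtrM _ (ltW C0)); apply: ler_wsqrtr.
    rewrite -exprM (mulnC _ 2) -lee_fin fineK ?s2_fin //.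
    exact: up.
  rewrite -mulrA ler_pM2l ?sqrtr_gt0 // ler_pdivlMl // -exprS -rhop -exprM.
  by apply: ler_wiXn2l; [exact: ltW|exact: rho1|exact: ltnW].
move=> s /andP[s0 srho].
have s1 : s <= 1 by apply: le_trans rho1; exact: ltW.
(* The choice [L = 2 s^p] makes [L / 2 = s^p], and [s < rho] puts [L] below [b - a]. *)
have Lb : 0 < 2 * s ^+ p < b - a.
  apply/andP; split; first by rewrite mulr_gt0 // exprn_gt0.
  have : s ^+ p < be by rewrite -rhop ltrXn2r // ?ltW // -?lt0n.
  by rewrite /be; lra.
have [c c0 low] := integral_trig_ge fS fae m0 a1 b1 E2 Lb.
exists (Num.sqrt c * s ^+ p) => [|n pn].
  by rewrite mulr_gt0 ?sqrtr_gt0 ?exprn_gt0.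
apply: (@le_trans _ _ (Num.sqrt c * (s ^+ p) ^+ (n %/ p).+1)).
  rewrite -mulrA ler_pM2l ?sqrtr_gt0 // -exprD -exprM.
  apply: ler_wiXn2l => //; first exact: ltW.
  by rewrite mulnS leq_add2l.
have sp0 : 0 <= (s ^+ p) ^+ (n %/ p).+1 by rewrite !exprn_ge0 // ltW.
rewrite -(ger0_norm sp0) -sqrtr_sqr -(sqrtrM _ (ltW c0)); apply: ler_wsqrtr.
rewrite -(exprM (s ^+ p)) (mulnC _ 2) -lee_fin fineK ?s2_fin //.
apply: le_ereal_inf_tmp => _ [d _ <-].
have := low n (n %/ p).+1 d (ltn0Sn _).
rewrite [2 * s ^+ p / 2](_ : _ = s ^+ p); last by field.
by apply; rewrite mulnA; exact: divp.
Qed.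

(** * The four families of sets *)

Lemma ler_cos (R : realType) : {in `[0, pi] &, {mono @cos R : x y /~ y <= x}}.
Proof. by move=> x y x0 y0; rewrite !leNgt ltr_cos. Qed.

Lemma cos_annulus (R : realType) (d e s : R) :
  0 <= d -> d <= e -> e <= pi -> `|s| <= pi ->
  (d <= `|s| <= e) = (cos e <= cos s <= cos d).
Proof.
move=> d0 de epi spi; rewrite -(cos_norm s) !ler_cos ?in_itv /= ?normr_ge0 ?spi //.
- by rewrite andbC.
- by rewrite d0 (le_trans de).
- by rewrite (le_trans d0).
Qed.

(** [cos (m (t - theta))] is [T_m] at [cos (t - theta)], hence depends only on the point of the
    circle. *)
Lemma ei_eq_cos (R : realType) (m : nat) (theta t t' : R) : ei t = ei t' ->
  cos (m%:R * (t - theta)) = cos (m%:R * (t' - theta)).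
Proof. by case=> c s; rewrite -!chebT_cos !cosB c s. Qed.

Lemma eiD2zpi (R : realType) (t : R) (z : int) : ei (t + 2 * pi * z%:~R) = ei t.
Proof. by rewrite /ei cosD2zpi sinD2zpi. Qed.

Lemma Gamma_adE (R : realType) (al de theta t : R) :
  0 < al -> 0 <= de -> al + de <= pi ->
  Gamma_ad al de theta (ei t) <->
  cos (de + al) <= cos (1%:R * (t - theta)) <= cos de.
Proof.
move=> al0 de0 alde; split=> [[t' /= ht /(ei_eq_cos 1 theta) <-]|].
  rewrite mul1r -cos_annulus //; [lra|lra|].
  by case/andP: ht => _ h; apply: le_trans h _; lra.
(* Conversely, take the representative with [t - theta] in [[-pi, pi[], where [cos_annulus]
   applies. *)
have [z /andP[z1 z2]] := angle_reduce (t - theta).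
have <- : cos (1%:R * (t + 2 * pi * z%:~R - theta)) = cos (1%:R * (t - theta)).
  by apply: ei_eq_cos; exact: eiD2zpi.
have spi : `|t + 2 * pi * z%:~R - theta| <= pi.
  by rewrite ler_norml; apply/andP; split; lra.
rewrite mul1r -cos_annulus //; [|lra|lra] => h.
by exists (t + 2 * pi * z%:~R) => //; exact: eiD2zpi.
Qed.

Lemma Gamma_arcE (R : realType) (al theta t : R) : 0 < al -> al <= pi ->
  Gamma_arc al theta (ei t) <-> cos al <= cos (1%:R * (t - theta)) <= 1.
Proof.
move=> al0 alpi; have := @Gamma_adE R al 0 theta t al0 (lexx 0).
rewrite addr0 add0r cos0 => /(_ alpi) <-.
by split=> -[t' /= h e]; exists t' => //=; move: h; rewrite normr_ge0 add0r.
Qed.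

Lemma Gamma_kE (R : realType) (k : nat) (al theta t : R) :
  (0 < k)%N -> 0 < al -> k%:R * al < 2 * pi ->
  Gamma_k k al theta (ei t) <->
  cos (k%:R * al / 2) <= cos (k%:R * (t - theta)) <= 1.
Proof.
move=> k0 al0 kal; have k0' : (0 : R) < k%:R by rewrite ltr0n.
have kn0 := lt0r_neq0 k0'.
have kal0 : 0 < k%:R * al by rewrite mulr_gt0.
split=> [[t' /= [j [jk hj]] /(ei_eq_cos k theta) <-]|].
  rewrite cos_le1 andbT.
  have -> : k%:R * (t' - theta) =
      k%:R * (t' - (theta + 2 * pi * j%:R / k%:R)) + 2 * pi * j%:R by field.
  rewrite cosD2npi -[X in _ <= X]cos_norm normrM normr_nat.
  have h : k%:R * `|t' - (theta + 2 * pi * j%:R / k%:R)| <= k%:R * al / 2.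
    by rewrite -[leRHS]mulrA ler_pM2l.
  rewrite ler_cos // in_itv /=; first by rewrite mulr_ge0 //; lra.
  by apply/andP; split; lra.
have [z /andP[z1 z2]] := angle_reduce (k%:R * (t - theta)).
move=> /andP[h _].
set y := k%:R * (t - theta) + 2 * pi * z%:~R in z1 z2.
have ypi : `|y| <= pi by rewrite ler_norml; apply/andP; split; lra.
have yal : `|y| <= k%:R * al / 2.
  have : 0 <= `|y| <= k%:R * al / 2.
    rewrite cos_annulus //; [|lra|lra].
    by rewrite cosD2zpi h cos0 cos_le1.
  by case/andP.
have kz : (k : int) != 0 by rewrite -lt0n.
(* The residue of [- z] modulo [k] selects the arc, the quotient counts full turns. *)
pose q := ((- z) %/ k)%Z; pose j := `|((- z) %% k)%Z|%N.
have jE : (j : int) = ((- z) %% k)%Z by rewrite gez0_abs // modz_ge0.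
have zE : - z = q * k + j by rewrite jE -divz_eq.
have zR : (z%:~R : R) = - (q%:~R * k%:R + j%:R).
  by rewrite -[z]opprK zE mulrNz intrD intrM -!pmulrn.
exists (t + 2 * pi * (- q)%:~R); last exact: eiD2zpi.
exists j; split.
  by rewrite -ltz_nat jE ltz_pmod.
have -> : t + 2 * pi * (- q)%:~R - (theta + 2 * pi * j%:R / k%:R) = y / k%:R.
  by rewrite /y zR mulrNz; field.
by rewrite normrM normfV normr_nat ler_pdivrMr // mulrC mulrA.
Qed.

(** Doubling the angle identifies opposite points and folds the four arcs onto two, with [al] and
    [de] doubled. *)
Lemma Delta_adE (R : realType) (al de theta t : R) :
  0 < al -> 0 <= de -> al + de <= pi / 2 ->
  Delta_ad al de theta (ei t) <->
  cos (2 * (de + al)) <= cos (2%:R * (t - theta)) <= cos (2 * de).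
Proof.
move=> al0 de0 alde; split=> [[t' /= ht /(ei_eq_cos 2 theta) <-]|].
  have dbl (w s : R) : `|w| = s -> de <= s <= de + al ->
      cos (2 * (de + al)) <= cos (2 * w) <= cos (2 * de).
    move=> ws /andP[h1 h2].
    have n2 : `|2 * w| = 2 * s by rewrite normrM ger0_norm // ws.
    rewrite -cos_annulus ?n2; first by apply/andP; split; lra.
    - by lra.
    - by lra.
    - by lra.
    - by lra.
  case: ht => [h|[/andP[h1 h2]|/andP[h1 h2]]].
  - exact: (dbl _ _ (erefl _) h).
  - have -> : cos (2 * (t' - theta)) = cos (2 * (t' - theta + pi)).
      by rewrite -(cosD2npi (2 * (t' - theta)) 1); congr cos; ring.
    apply: (dbl _ (t' - theta + pi)); first by rewrite ger0_norm //; lra.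
    by apply/andP; split; lra.
  have -> : cos (2 * (t' - theta)) = cos (2 * (t' - theta - pi)).
    by rewrite -(cosD2npi (2 * (t' - theta - pi)) 1); congr cos; ring.
  apply: (dbl _ (pi - (t' - theta))); first by rewrite ler0_norm; lra.
  by apply/andP; split; lra.
have [z /andP[z1 z2]] := angle_reduce (t - theta).
have <- : cos (2%:R * (t + 2 * pi * z%:~R - theta)) = cos (2%:R * (t - theta)).
  by apply: ei_eq_cos; exact: eiD2zpi.
move=> h; exists (t + 2 * pi * z%:~R); last exact: eiD2zpi.
have {z1 z2} : - pi <= t + 2 * pi * z%:~R - theta < pi.
  by apply/andP; split; lra.
move: h; set s := t + 2 * pi * z%:~R - theta => h /andP[s1 s2] /=; rewrite -/s.
(* Used with [w] equal to [s], [s - pi] or [s + pi], whichever lies within [pi / 2] of 0. *)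
have half (w : R) : cos (2 * s) = cos (2 * w) -> `|w| <= pi / 2 ->
    de <= `|w| <= de + al.
  move=> sw wpi; move: h; rewrite sw -cos_annulus; try lra.
    by rewrite normrM ger0_norm // => /andP[? ?]; apply/andP; split; lra.
  by rewrite normrM ger0_norm //; lra.
case: (leP `|s| (pi / 2)) => spi; first by left; exact: half.
right; case: (leP 0 s) spi => s0 spi.
  rewrite ger0_norm // in spi; right.
  have /andP[] : de <= `|s - pi| <= de + al.
    apply: half; last by rewrite ler0_norm; lra.
    by rewrite -(cosD2npi (2 * (s - pi)) 1); congr cos; ring.
  by rewrite ler0_norm; [move=> h1 h2; apply/andP; split; lra|lra].
rewrite ltr0_norm // in spi; left.
have /andP[] : de <= `|s + pi| <= de + al.
  apply: half; last by rewrite ger0_norm; lra.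
  by rewrite -(cosD2npi (2 * s) 1); congr cos; ring.
by rewrite ger0_norm; [move=> h1 h2; apply/andP; split; lra|lra].
Qed.

(** * Evaluation of the four limits *)

(** Rewrites the half-length [(b - a) / 2] for [b = cos x] and [a = cos (x + y)]; for [x = 0] it is
    a square. *)
Lemma half_cos_diff (R : realType) (x y : R) :
  (cos x - cos (x + y)) / 2 = sin (y / 2) * sin (y / 2 + x).
Proof.
have -> : cos x = cos ((y / 2 + x) - y / 2) by congr cos; ring.
have -> : cos (x + y) = cos ((y / 2 + x) + y / 2) by congr cos; field.
by move: (y / 2 + x) => v; rewrite cosB cosD; field.
Qed.

Unset Implicit Arguments.

Theorem mainTheorem6 (R : realType) (f : R -> R) :
  spectral_density f ->
  {ae lebesgue_measure, forall x : R, Lam x -> clEf f (ei x) -> 0 < f x} ->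
  (forall alpha theta0 : R, 0 < alpha < pi ->
     clEf f = Gamma_arc alpha theta0 ->
     (fun n : nat => sigma n f `^ (n%:R^-1)) @ \oo --> sin (alpha / 2)) /\
  (forall (k : nat) (alpha theta0 : R), (2 <= k)%N -> 0 < alpha ->
     k%:R * alpha < 2 * pi ->
     clEf f = Gamma_k k alpha theta0 ->
     (fun n : nat => sigma n f `^ (n%:R^-1)) @ \oo -->
        sin (k%:R * alpha / 4) `^ (k%:R^-1)) /\
  (forall alpha delta theta0 : R, 0 < alpha -> 0 <= delta -> alpha + delta <= pi ->
     clEf f = Gamma_ad alpha delta theta0 ->
     (fun n : nat => sigma n f `^ (n%:R^-1)) @ \oo -->
        (sin (alpha / 2) * sin (alpha / 2 + delta)) `^ (2%:R^-1)) /\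
  (forall alpha delta theta0 : R, 0 < alpha -> 0 <= delta -> alpha + delta <= pi / 2 ->
     clEf f = Delta_ad alpha delta theta0 ->
     (fun n : nat => sigma n f `^ (n%:R^-1)) @ \oo -->
        (sin alpha * sin (alpha + 2 * delta)) `^ (4%:R^-1)).
Proof.
move=> fS fae.
have cos_lt (x y : R) : 0 <= x -> x < y -> y <= pi -> cos y < cos x.
  move=> x0 xy ypi; rewrite ltr_cos // in_itv /=; apply/andP; split; lra.
split; [|split; [|split]].
- move=> al theta /andP[al0 alpi] E.
  have := @sigma_root_cvg R f 1 theta (cos al) 1 fS fae isT (cos_geN1 _).
  rewrite -[X in _ < X -> _]cos0 => /(_ (cos_lt _ _ (lexx 0) al0 (ltW alpi)) (lexx 1)).
  (* The exponent [1 / 2] undoes this square. *)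
  have -> : (1 - cos al) / 2 = sin (al / 2) ^+ 2.
    by have := half_cos_diff 0 al; rewrite cos0 add0r addr0 -expr2.
  have s0 : 0 <= sin (al / 2) by apply: sin_ge0_pi; apply/andP; split; lra.
  rewrite muln1 -powR_mulrn // -powRrM mulfV // powRr1 //; apply => t.
  by rewrite E Gamma_arcE // ltW.
- move=> k al theta k2 al0 kal E.
  have k0 : (0 < k)%N by exact: leq_trans k2.
  have k0' : (0 : R) < k%:R by rewrite ltr0n.
  have kal0 : 0 < k%:R * al by rewrite mulr_gt0.
  have := @sigma_root_cvg R f k theta (cos (k%:R * al / 2)) 1 fS fae k0 (cos_geN1 _).
  rewrite -[X in _ < X -> _]cos0 => H; have := H (cos_lt _ _ _ _ _) (lexx 1).
  (* The square turns the exponent [1 / (2k)] into [1 / k]. *)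
  have -> : (1 - cos (k%:R * al / 2)) / 2 = sin (k%:R * al / 4) ^+ 2.
    have := half_cos_diff 0 (k%:R * al / 2); rewrite cos0 add0r addr0 -expr2 => ->.
    by congr (sin _ ^+ 2); field.
  have s0 : 0 <= sin (k%:R * al / 4) by apply: sin_ge0_pi; apply/andP; split; lra.
  rewrite -powR_mulrn // -powRrM natrM invfM mulrA mulfV ?pnatr_eq0 // mul1r.
  apply; try lra.
  by move=> t; rewrite E Gamma_kE.
- move=> al de theta al0 de0 alde E.
  rewrite -half_cos_diff.
  apply: (@sigma_root_cvg R f 1 theta) => //; rewrite ?cos_geN1 ?cos_le1 //.
    by apply: cos_lt; lra.
  by move=> t; rewrite E Gamma_adE.
move=> al de theta al0 de0 alde E.
(* [half_cos_diff] with [x = 2 de] and [y = 2 al], the doubled parameters of [Delta_adE]. *)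
have -> : sin al * sin (al + 2 * de) = (cos (2 * de) - cos (2 * (de + al))) / 2.
  by rewrite mulrDr half_cos_diff; congr (sin _ * sin _); field.
apply: (@sigma_root_cvg R f 2 theta) => //; rewrite ?cos_geN1 ?cos_le1 //.
  by apply: cos_lt; lra.
by move=> t; rewrite E Delta_adE.
Qed.
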